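(* The Cartan canonical connection $C\Gamma=(H^\gamma_{\alpha\beta},G^i_{j\gamma},L^i_{jk},C^{i(\gamma)}_{j(k)})$ of the generalized metrical multi-time Lagrange space $RGOGML^n_p$ has the adapted coefficients $$H^\gamma_{\alpha\beta}=H^\gamma_{\alpha\beta}\ \text{(the Christoffel symbols of } h_{\alpha\beta}),$$ $$G^i_{j\gamma}=\frac12\left[(A^iA_j)_{//\gamma}-\frac{A^iA^m}{1+A_0}(A_mA_j)_{//\gamma}\right],$$ $$L^i_{jk}=(\gamma_{jkm}+A_{jkm})\left[\varphi^{im}-\frac{A^iA^m}{1+A_0}\right],$$ $$C^{i(\gamma)}_{j(k)}=C^\gamma_{jkm}\left[\varphi^{im}-\frac{A^iA^m}{1+A_0}\right],$$ where $A^i=\varphi^{im}A_m$, $A_0=A^mA_m$ and $$\gamma_{ijm}=\frac12\left[\frac{\partial\varphi_{im}}{\partial x^j}+\frac{\partial\varphi_{jm}}{\partial x^i}-\frac{\partial\varphi_{ij}}{\partial x^m}\right],$$ $$A_{ijm}=\frac12\left[\frac{\delta(A_iA_m)}{\delta x^j}+\frac{\delta(A_jA_m)}{\delta x^i}-\frac{\delta(A_iA_j)}{\delta x^m}\right],$$ $$C^\gamma_{ijm}=\frac12\left[\frac{\partial(A_iA_m)}{\partial x^j_\gamma}+\frac{\partial(A_jA_m)}{\partial x^i_\gamma}-\frac{\partial(A_iA_j)}{\partial x^m_\gamma}\right].$$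
   Context: Setting. $T$ and $M$ are smooth manifolds of dimensions $p$ and $n$, with local coordinates $(t^\alpha)$ (Greek indices, $1..p$) and $(x^i)$ (Latin indices, $1..n$), and semi-Riemannian metrics $h_{\alpha\beta}(t)$ on $T$, $\varphi_{ij}(x)$ on $M$, with Christoffel symbols $H^\alpha_{\beta\gamma}$ and $\gamma^i_{jk}$ respectively. $J^1(T,M)$ is the 1-jet bundle with induced coordinates $(t^\alpha,x^i,x^i_\alpha)$. Repeated indices are summed. $A_i(t^\gamma,x^k,x^k_\gamma)$ are the components of a d-tensor (distinguished tensor) on $J^1(T,M)$, i.e. they transform like the components of a covector on $M$. Put $g_{ij}=\varphi_{ij}+A_iA_j$, assumed of rank $n$ and constant signature; its inverse is $g^{ij}=\varphi^{ij}-\frac{1}{1+A_0}A^iA^j$. The space $RGOGML^n_p$ is $J^1(T,M)$ with the vertical metrical d-tensor $G^{(\alpha)(\beta)}_{(i)(j)}=h^{\alpha\beta}g_{ij}$ and the nonlinear connection $\Gamma$ with components $M^{(i)}_{(\alpha)\beta}=-H^\mu_{\alpha\beta}x^i_\mu$, $N^{(i)}_{(\alpha)j}=\gamma^i_{jm}x^m_\alpha$. The adapted basis of vector fields is $$\frac{\delta}{\delta t^\alpha}=\frac{\partial}{\partial t^\alpha}-M^{(j)}_{(\beta)\alpha}\frac{\partial}{\partial x^j_\beta},\quad \frac{\delta}{\delta x^i}=\frac{\partial}{\partial x^i}-N^{(j)}_{(\beta)i}\frac{\partial}{\partial x^j_\beta},\quad \frac{\partial}{\partial x^i_\alpha}.$$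 An $h$-normal $\Gamma$-linear connection with coefficients $(H^\gamma_{\alpha\beta},G^i_{j\gamma},L^i_{jk},C^{i(\gamma)}_{j(k)})$ is the linear connection $\nabla$ on $J^1(T,M)$ given by: along $\delta/\delta t^\gamma$: $\frac{\delta}{\delta t^\beta}\mapsto H^\alpha_{\beta\gamma}\frac{\delta}{\delta t^\alpha}$, $\frac{\delta}{\delta x^j}\mapsto G^i_{j\gamma}\frac{\delta}{\delta x^i}$, $\frac{\partial}{\partial x^i_\beta}\mapsto(\delta^\beta_\alpha G^k_{i\gamma}-\delta^k_iH^\beta_{\alpha\gamma})\frac{\partial}{\partial x^k_\alpha}$; along $\delta/\delta x^k$: $\frac{\delta}{\delta t^\beta}\mapsto0$, $\frac{\delta}{\delta x^j}\mapsto L^i_{jk}\frac{\delta}{\delta x^i}$, $\frac{\partial}{\partial x^j_\beta}\mapsto L^i_{jk}\frac{\partial}{\partial x^i_\beta}$; along $\partial/\partial x^k_\gamma$: $\frac{\delta}{\delta t^\beta}\mapsto0$, $\frac{\delta}{\delta x^j}\mapsto C^{i(\gamma)}_{j(k)}\frac{\delta}{\delta x^i}$, $\frac{\partial}{\partial x^j_\beta}\mapsto C^{i(\gamma)}_{j(k)}\frac{\partial}{\partial x^i_\beta}$. Here $H^\gamma_{\alpha\beta}$ are always the Christoffel symbols of $h$. The Cartan canonical connection $C\Gamma$ is the unique $h$-normal $\Gamma$-linear connection such that (i) $g_{ij\vert k}=0$ and $g_{ij}\vert^{(\gamma)}_{(k)}=0$ (covariant derivatives along $\delta/\delta x^k$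 and $\partial/\partial x^k_\gamma$); (ii) $G^k_{j\gamma}=\frac{g^{ki}}{2}\frac{\delta g_{ij}}{\delta t^\gamma}$, $L^k_{ij}=L^k_{ji}$, $C^{i(\gamma)}_{j(k)}=C^{i(\gamma)}_{k(j)}$. The symbol $_{//\gamma}$ is the temporal covariant derivative of the Berwald connection $B\Gamma=(H^\gamma_{\alpha\beta},0,\gamma^i_{jk},0)$ (the $h$-normal $\Gamma$-linear connection with these coefficients); on d-tensors $D$ having only Latin indices, $D_{//\gamma}=\delta D/\delta t^\gamma$ componentwise. *)

(* Defs.v *)
From mathcomp Require Import all_boot all_order all_algebra.
From mathcomp Require Import all_classical all_reals all_analysis.

Set Implicit Arguments.
Unset Strict Implicit.
Unset Printing Implicit Defensive.

Import Order.TTheory GRing.Theory Num.Theory.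
Import numFieldNormedType.Exports.

Local Open Scope classical_set_scope.
Local Open Scope ring_scope.

(* C^k on U, for U open in a finite-dimensional normed space V: in finite
   dimension f is C^(k+1) iff it is differentiable and all its directional
   derivatives (for fixed directions) are C^k. *)
Fixpoint Ck_on (R : realType) (V W : normedModType R) (k : nat) (U : set V)
    (f : V -> W) : Prop :=
  if k is k'.+1 then
    (forall x, U x -> differentiable f x) /\
    (forall v, Ck_on k' U (fun x => 'D_v f x))
  else forall x, U x -> {for x, continuous f}.

Definition smooth_on (R : realType) (V W : normedModType R) (U : set V)
    (f : V -> W) : Prop := forall k, Ck_on k U f.

(* [param c] is the inverse of the chart [ccoord c]; both are total functions,
   meaningful on [ccoord c @` cdom c] and on [cdom c] respectively. *)
Record manifold (R : realType) (n : nat) := Manifold {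
  mpoint :> topologicalType;
  mhausdorff : hausdorff_space mpoint;
  mcountable : second_countable (T := mpoint);
  chart : Type;
  cdom : chart -> set mpoint;
  ccoord : chart -> mpoint -> 'rV[R]_n;
  param : chart -> 'rV[R]_n -> mpoint;
  cdom_open : forall c, open (cdom c);
  cdom_cover : forall x, exists c, cdom c x;
  ccoordK : forall c x, cdom c x -> param c (ccoord c x) = x;
  ccod_open : forall c, open (ccoord c @` cdom c);
  ccoord_continuous : forall c x, cdom c x -> {for x, continuous (ccoord c)};
  param_continuous : forall c u, (ccoord c @` cdom c) u ->
    {for u, continuous (param c)};
  transition_smooth : forall c c',
    smooth_on (ccoord c @` (cdom c `&` cdom c')) (ccoord c' \o param c) }.

Definition ccod (R : realType) (n : nat) (M : manifold R n) (c : chart M) :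
  set 'rV[R]_n := ccoord c @` cdom c.

Definition overlap (R : realType) (n : nat) (M : manifold R n)
  (c c' : chart M) : set 'rV[R]_n := ccoord c @` (cdom c `&` cdom c').

Definition transition (R : realType) (n : nat) (M : manifold R n)
  (c c' : chart M) : 'rV[R]_n -> 'rV[R]_n := ccoord c' \o param c.

(* k positive and n - k negative squares *)
Definition has_signature (R : realType) (n : nat) (S : 'M[R]_n) (k : nat) :=
  (k <= n)%N /\
  exists2 P : 'M[R]_n, P \in unitmx & P *m S *m P^T = pid_mx k - copid_mx k.

(* In ['J tau u], the entry (i, j) is the partial derivative of the j-th new
   coordinate with respect to the i-th old one. *)
Record semi_riemannian (R : realType) (n : nat) (M : manifold R n) :=
  SemiRiemannian {
  met : chart M -> 'rV[R]_n -> 'M[R]_n;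
  met_smooth : forall c, smooth_on (ccod c) (met c);
  met_sym : forall c u, ccod c u -> (met c u)^T = met c u;
  met_signature : exists k, forall c u, ccod c u -> has_signature (met c u) k;
  met_law : forall c c' u, overlap c c' u ->
    met c u = 'J (transition c c') u *m met c' (transition c c' u)
              *m ('J (transition c c') u)^T }.

Definition partial (R : realType) (n : nat) (i : 'I_n) (f : 'rV[R]_n -> R) :
  'rV[R]_n -> R := fun u => 'D_(delta_mx 0 i) f u.

(* [christoffel g i j k] has upper index i and lower indices j, k. *)
Definition christoffel (R : realType) (n : nat) (g : 'rV[R]_n -> 'M[R]_n)
    (i j k : 'I_n) (u : 'rV[R]_n) : R :=
  2^-1 * \sum_m invmx (g u) i m *
    (partial j (fun w => g w m k) u + partial k (fun w => g w m j) u
     - partial m (fun w => g w j k) u).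

(* Induced coordinates (t, x, v) on the 1-jet bundle, v i a = x^i_a.  A chart
   c of T and a chart d of M induce a chart of J^1(T, M) with image
   [jdom c d]; the tangent spaces at its points are the same vector space. *)
Definition jets (R : realType) (p n : nat) : normedModType R :=
  ('rV[R]_p * 'rV[R]_n * 'M[R]_(n, p))%type.

Definition jdom (R : realType) (p n : nat) (T : manifold R p)
    (M : manifold R n) (c : chart T) (d : chart M) : set (jets R p n) :=
  [set y | ccod c y.1.1 /\ ccod d y.1.2].

Definition joverlap (R : realType) (p n : nat) (T : manifold R p)
    (M : manifold R n) (c c' : chart T) (d d' : chart M) :
    set (jets R p n) :=
  [set y | overlap c c' y.1.1 /\ overlap d d' y.1.2].

(* v'^j_b = (dx'^j/dx^i) (dt^a/dt'^b) v^i_a *)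
Definition jtransition (R : realType) (p n : nat) (T : manifold R p)
    (M : manifold R n) (c c' : chart T) (d d' : chart M) (y : jets R p n) :
    jets R p n :=
  (transition c c' y.1.1, transition d d' y.1.2,
   ('J (transition d d') y.1.2)^T *m y.2
     *m ('J (transition c' c) (transition c c' y.1.1))^T).

Record dcovector (R : realType) (p n : nat) (T : manifold R p)
    (M : manifold R n) := DCovector {
  dcomps : chart T -> chart M -> jets R p n -> 'rV[R]_n;
  dcomps_smooth : forall c d, smooth_on (jdom c d) (dcomps c d);
  dcomps_law : forall c c' d d' y, joverlap c c' d d' y ->
    dcomps c d y = dcomps c' d' (jtransition c c' d d' y)
                  *m ('J (transition d d') y.1.2)^T }.

(* A linear connection on J^1(T, M), through its local expressions:
   [conn c d y v Y] is the covariant derivative at y, in the direction v, of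
   the vector field Y (all in the coordinates induced by c and d).  The
   vector field Y may be defined only on a neighbourhood of y. *)
Record linear_connection (R : realType) (p n : nat) (T : manifold R p)
    (M : manifold R n) := LinearConnection {
  conn : chart T -> chart M -> jets R p n -> jets R p n ->
         (jets R p n -> jets R p n) -> jets R p n;
  conn_local : forall c d (W : set (jets R p n)) y v Y Z, open W ->
    W `<=` jdom c d -> W y -> smooth_on W Y -> {in W, Y =1 Z} ->
    conn c d y v Y = conn c d y v Z;
  conn_linear : forall c d (W : set (jets R p n)) y (a : R) v w Y, open W ->
    W `<=` jdom c d -> W y -> smooth_on W Y ->
    conn c d y (a *: v + w) Y = a *: conn c d y v Y + conn c d y w Y;
  conn_add : forall c d (W : set (jets R p n)) y v Y Z, open W ->
    W `<=` jdom c d -> W y -> smooth_on W Y -> smooth_on W Z ->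
    conn c d y v (fun z => Y z + Z z) = conn c d y v Y + conn c d y v Z;
  conn_leibniz : forall c d (W : set (jets R p n)) y v (f : jets R p n -> R) Y,
    open W -> W `<=` jdom c d -> W y -> smooth_on W f -> smooth_on W Y ->
    conn c d y v (fun z => f z *: Y z) =
    'D_v f y *: Y y + f y *: conn c d y v Y;
  conn_smooth : forall c d (W : set (jets R p n)) X Y, open W ->
    W `<=` jdom c d -> smooth_on W X -> smooth_on W Y ->
    smooth_on W (fun y => conn c d y (X y) Y);
  conn_law : forall c c' d d' (W : set (jets R p n)) y v Y Y', open W ->
    W `<=` joverlap c c' d d' -> W y -> smooth_on W Y ->
    (forall z, W z -> Y' (jtransition c c' d d' z) =
                      'd (jtransition c c' d d') z (Y z)) ->
    conn c' d' (jtransition c c' d d' y) ('d (jtransition c c' d d') y v) Y' =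
    'd (jtransition c c' d d') y (conn c d y v Y) }.

(* From here to [cartan_at], h : 'rV_p -> 'M_p and phi : 'rV_n -> 'M_n are the
   components of the two metrics, and A those of the d-covector, in fixed
   charts. *)

(* [Mcon h j b a] is M^(j)_(b)a, [Ncon phi j b i] is N^(j)_(b)i. *)
Definition Mcon (R : realType) (p n : nat) (h : 'rV[R]_p -> 'M[R]_p)
    (j : 'I_n) (b a : 'I_p) (y : jets R p n) : R :=
  - \sum_m christoffel h m b a y.1.1 * y.2 j m.

Definition Ncon (R : realType) (p n : nat) (phi : 'rV[R]_n -> 'M[R]_n)
    (j : 'I_n) (b : 'I_p) (i : 'I_n) (y : jets R p n) : R :=
  \sum_m christoffel phi j i m y.1.2 * y.2 m b.

Definition delta_t (R : realType) (p n : nat) (h : 'rV[R]_p -> 'M[R]_p)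
    (a : 'I_p) (y : jets R p n) : jets R p n :=
  (delta_mx 0 a, 0, \matrix_(j, b) - Mcon h j b a y).

Definition delta_x (R : realType) (p n : nat) (phi : 'rV[R]_n -> 'M[R]_n)
    (i : 'I_n) (y : jets R p n) : jets R p n :=
  (0, delta_mx 0 i, \matrix_(j, b) - Ncon phi j b i y).

Definition delta_v (R : realType) (p n : nat) (i : 'I_n) (a : 'I_p)
    (y : jets R p n) : jets R p n :=
  (0, 0, delta_mx i a).

Definition dt (R : realType) (p n : nat) (h : 'rV[R]_p -> 'M[R]_p)
    (a : 'I_p) (f : jets R p n -> R) (y : jets R p n) : R :=
  'D_(delta_t h a y) f y.

Definition dx (R : realType) (p n : nat) (phi : 'rV[R]_n -> 'M[R]_n)
    (i : 'I_n) (f : jets R p n -> R) (y : jets R p n) : R :=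
  'D_(delta_x phi i y) f y.

Definition dv (R : realType) (p n : nat) (i : 'I_n) (a : 'I_p)
    (f : jets R p n -> R) (y : jets R p n) : R :=
  'D_(delta_v i a y) f y.

(* cH c a b : H^c_ab;  cG i j c : G^i_jc;  cL i j k : L^i_jk;
   cC i j k c : C^i(c)_j(k). *)
Record adapted_coefs (R : realType) (p n : nat) := AdaptedCoefs {
  cH : 'I_p -> 'I_p -> 'I_p -> jets R p n -> R;
  cG : 'I_n -> 'I_n -> 'I_p -> jets R p n -> R;
  cL : 'I_n -> 'I_n -> 'I_n -> jets R p n -> R;
  cC : 'I_n -> 'I_n -> 'I_n -> 'I_p -> jets R p n -> R }.

Definition hnormal_at (R : realType) (p n : nat) (h : 'rV[R]_p -> 'M[R]_p)
    (phi : 'rV[R]_n -> 'M[R]_n) (K : adapted_coefs R p n)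
    (D : jets R p n -> (jets R p n -> jets R p n) -> jets R p n)
    (y : jets R p n) : Prop :=
  (forall a b c, cH K c a b y = christoffel h c a b y.1.1) /\
  (forall c,
    [/\ forall b, D (delta_t h c y) (delta_t h b) =
          \sum_a cH K a b c y *: delta_t h a y,
        forall j, D (delta_t h c y) (delta_x phi j) =
          \sum_i cG K i j c y *: delta_x phi i y
      & forall i b, D (delta_t h c y) (delta_v i b) =
          \sum_k \sum_a ((a == b)%:R * cG K k i c y
                         - (k == i)%:R * cH K b a c y) *: delta_v k a y]) /\
  (forall k,
    [/\ forall b, D (delta_x phi k y) (delta_t h b) = 0,
        forall j, D (delta_x phi k y) (delta_x phi j) =
          \sum_i cL K i j k y *: delta_x phi i y
      & forall j b, D (delta_x phi k y) (delta_v j b) =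
          \sum_i cL K i j k y *: delta_v i b y]) /\
  (forall k c,
    [/\ forall b, D (delta_v k c y) (delta_t h b) = 0,
        forall j, D (delta_v k c y) (delta_x phi j) =
          \sum_i cC K i j k c y *: delta_x phi i y
      & forall j b, D (delta_v k c y) (delta_v j b) =
          \sum_i cC K i j k c y *: delta_v i b y]).

(* [tcov11 h K B i j c] is B^i_j/c, [hcov02 phi K B i j k] is B_ij|k and
   [vcov02 K B i j k c] is B_ij|^(c)_(k). *)
Definition tcov11 (R : realType) (p n : nat) (h : 'rV[R]_p -> 'M[R]_p)
    (K : adapted_coefs R p n) (B : 'I_n -> 'I_n -> jets R p n -> R)
    (i j : 'I_n) (c : 'I_p) (y : jets R p n) : R :=
  dt h c (B i j) y + \sum_m B m j y * cG K i m c y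
  - \sum_m B i m y * cG K m j c y.

Definition tcov02 (R : realType) (p n : nat) (h : 'rV[R]_p -> 'M[R]_p)
    (K : adapted_coefs R p n) (B : 'I_n -> 'I_n -> jets R p n -> R)
    (i j : 'I_n) (c : 'I_p) (y : jets R p n) : R :=
  dt h c (B i j) y - \sum_m B m j y * cG K m i c y
  - \sum_m B i m y * cG K m j c y.

Definition hcov02 (R : realType) (p n : nat) (phi : 'rV[R]_n -> 'M[R]_n)
    (K : adapted_coefs R p n) (B : 'I_n -> 'I_n -> jets R p n -> R)
    (i j k : 'I_n) (y : jets R p n) : R :=
  dx phi k (B i j) y - \sum_m B m j y * cL K m i k y
  - \sum_m B i m y * cL K m j k y.

Definition vcov02 (R : realType) (p n : nat)
    (K : adapted_coefs R p n) (B : 'I_n -> 'I_n -> jets R p n -> R)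
    (i j k : 'I_n) (c : 'I_p) (y : jets R p n) : R :=
  dv k c (B i j) y - \sum_m B m j y * cC K m i k c y
  - \sum_m B i m y * cC K m j k c y.

Definition berwald (R : realType) (p n : nat) (h : 'rV[R]_p -> 'M[R]_p)
    (phi : 'rV[R]_n -> 'M[R]_n) : adapted_coefs R p n :=
  AdaptedCoefs (fun c a b y => christoffel h c a b y.1.1)
    (fun _ _ _ _ => 0)
    (fun i j k y => christoffel phi i j k y.1.2)
    (fun _ _ _ _ _ => 0).

Definition gmx (R : realType) (p n : nat) (phi : 'rV[R]_n -> 'M[R]_n)
    (A : jets R p n -> 'rV[R]_n) (y : jets R p n) : 'M[R]_n :=
  \matrix_(i, j) (phi y.1.2 i j + A y 0 i * A y 0 j).

(* The vertical metrical d-tensor h^ab g_ij. *)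
Definition vertical_metric (R : realType) (p n : nat)
    (h : 'rV[R]_p -> 'M[R]_p) (phi : 'rV[R]_n -> 'M[R]_n)
    (A : jets R p n -> 'rV[R]_n) (a b : 'I_p) (i j : 'I_n)
    (y : jets R p n) : R :=
  invmx (h y.1.1) a b * gmx phi A y i j.

Definition cartan_at (R : realType) (p n : nat) (h : 'rV[R]_p -> 'M[R]_p)
    (phi : 'rV[R]_n -> 'M[R]_n) (A : jets R p n -> 'rV[R]_n)
    (K : adapted_coefs R p n) (y : jets R p n) : Prop :=
  let g i j := fun z => gmx phi A z i j in
  [/\ forall i j k, hcov02 phi K g i j k y = 0,
      forall i j k c, vcov02 K g i j k c y = 0,
      forall k j c, cG K k j c y =
        \sum_i invmx (gmx phi A y) k i / 2 * dt h c (g i j) y,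
      forall i j k, cL K k i j y = cL K k j i y
    & forall i j k c, cC K i j k c y = cC K i k j c y].

Definition Aup (R : realType) (p n : nat) (phi : 'rV[R]_n -> 'M[R]_n)
    (A : jets R p n -> 'rV[R]_n) (i : 'I_n) (y : jets R p n) : R :=
  \sum_m invmx (phi y.1.2) i m * A y 0 m.

Definition A0 (R : realType) (p n : nat) (phi : 'rV[R]_n -> 'M[R]_n)
    (A : jets R p n -> 'rV[R]_n) (y : jets R p n) : R :=
  \sum_m Aup phi A m y * A y 0 m.

Definition gamma_low (R : realType) (n : nat) (phi : 'rV[R]_n -> 'M[R]_n)
    (i j m : 'I_n) (u : 'rV[R]_n) : R :=
  2^-1 * (partial j (fun w => phi w i m) u + partial i (fun w => phi w j m) u
          - partial m (fun w => phi w i j) u).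

Definition A_low (R : realType) (p n : nat) (phi : 'rV[R]_n -> 'M[R]_n)
    (A : jets R p n -> 'rV[R]_n) (i j m : 'I_n) (y : jets R p n) : R :=
  2^-1 * (dx phi j (fun z => A z 0 i * A z 0 m) y
          + dx phi i (fun z => A z 0 j * A z 0 m) y
          - dx phi m (fun z => A z 0 i * A z 0 j) y).

(* [C_low A i j m c] is C^c_ijm. *)
Definition C_low (R : realType) (p n : nat) (A : jets R p n -> 'rV[R]_n)
    (i j m : 'I_n) (c : 'I_p) (y : jets R p n) : R :=
  2^-1 * (dv j c (fun z => A z 0 i * A z 0 m) y
          + dv i c (fun z => A z 0 j * A z 0 m) y
          - dv m c (fun z => A z 0 i * A z 0 j) y).

(* Rank n and constant signature of g_ij. *)
Definition gmx_regular (R : realType) (p n : nat) (T : manifold R p)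
    (M : manifold R n) (phi : semi_riemannian M) (A : dcovector T M) : Prop :=
  (forall c d y, jdom c d y -> \rank (gmx (met phi d) (dcomps A c d) y) = n) /\
  (exists k, forall c d y, jdom c d y ->
     has_signature (gmx (met phi d) (dcomps A c d) y) k).

Definition is_hnormal (R : realType) (p n : nat) (T : manifold R p)
    (M : manifold R n) (h : semi_riemannian T) (phi : semi_riemannian M)
    (D : linear_connection T M)
    (K : chart T -> chart M -> adapted_coefs R p n) : Prop :=
  forall c d y, jdom c d y ->
    hnormal_at (met h c) (met phi d) (K c d) (conn D c d y) y.

(* D, with adapted coefficients K, is the Cartan canonical connection. *)
Definition is_cartan (R : realType) (p n : nat) (T : manifold R p)
    (M : manifold R n) (h : semi_riemannian T) (phi : semi_riemannian M)
    (A : dcovector T M) (D : linear_connection T M)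
    (K : chart T -> chart M -> adapted_coefs R p n) : Prop :=
  is_hnormal h phi D K /\
  forall c d y, jdom c d y ->
    cartan_at (met h c) (met phi d) (dcomps A c d) (K c d) y.

(* Main.v *)
Require Import Defs.
From mathcomp Require Import all_boot all_order all_algebra.
From mathcomp Require Import all_classical all_reals all_analysis.
From mathcomp Require Import ring.

Set Implicit Arguments.
Unset Strict Implicit.
Unset Printing Implicit Defensive.

Import Order.TTheory GRing.Theory Num.Theory.
Import numFieldNormedType.Exports.

Local Open Scope classical_set_scope.
Local Open Scope ring_scope.

(** Each family of coefficients is determined at a point by an algebraic
    argument.  Metric compatibility together with symmetry in the lower indices
    forces the Christoffel formula for [L] (with the derivatives delta/delta x^k)
    and, for each fixed temporal index, for [C] (with the vertical derivatives);
    this is [metric_torsionfree_coefs], in which the derivatives of the metric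
    are arbitrary numbers.  The coefficients [G] are prescribed in terms of the
    metric to begin with.

    What remains is to expand the formulas for g_ij = phi_ij + A_i A_j.  The
    inverse of g is given by the Sherman-Morrison formula, [invmx_gmxE].  The
    derivative of g splits into those of phi and of A_i A_j, [derive_gmx], and
    phi depends on x alone: its part is the partial derivative along
    delta/delta x^k, whence the symbols gamma_ijm, and vanishes along
    delta/delta t^a and the vertical directions, which have no x-component.
    For the same reason phi^im commutes with delta/delta t^a, so that
    phi^im (A_m A_j)_//c = (A^i A_j)_//c, [derive_raised_product]; this is the
    first term of the formula for [G]. *)

(** * Linear algebra *)

(** The normal form pid - copid is a diagonal matrix of signs, hence an
    involution. *)
Lemma has_signature_unitmx (R : realType) (n : nat) (S : 'M[R]_n) (k : nat) :
  has_signature S k -> S \in unitmx.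
Proof.
case=> le_kn [P _ eqS].
have sqr1 : (pid_mx k - copid_mx k) *m (pid_mx k - copid_mx k) = 1%:M :> 'M[R]_n.
  have pq : pid_mx k *m copid_mx k = 0 :> 'M[R]_n by apply: mul_pid_mx_copid.
  have qp : copid_mx k *m pid_mx k = 0 :> 'M[R]_n by apply: mul_copid_mx_pid.
  have qq : copid_mx k *m copid_mx k = copid_mx k :> 'M[R]_n.
    exact: copid_mx_id.
  have p1 : pid_mx k + copid_mx k = 1%:M :> 'M[R]_n by rewrite addrC subrK.
  move: (copid_mx k) pq qp qq p1 => q pq qp qq p1.
  by rewrite mulmxBl !mulmxBr pid_mx_id // pq qp qq subr0 sub0r opprK.
have [unitPS _] := mulmx1_unit (etrans (congr1 (mulmx^~ _) eqS) sqr1).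
by have := unitPS; rewrite !unitmx_mul => /andP[/andP[]].
Qed.

(** The Sherman-Morrison formula, for a symmetric update.  The denominator
    cannot vanish: b (S + a^T a) = (1 + s) a, so 1 + s = 0 would put b in the
    kernel of an invertible matrix, and then b = 0 gives s = 0. *)
Lemma rank_one_update_inv (F : fieldType) (n : nat) (S : 'M[F]_n)
    (a b : 'rV[F]_n) :
  S^T = S -> S \in unitmx -> S + a^T *m a \in unitmx -> b *m S = a ->
  let s := (b *m a^T) 0 0 in
  invmx (S + a^T *m a) = invmx S - (1 + s)^-1 *: (b^T *m b).
Proof.
move=> symS unitS unitG bS s.
have baT : b *m a^T = s%:M by apply: mx11_scalar.
have abT : a *m b^T = s%:M.
  by rewrite -[RHS]tr_scalar_mx -baT trmx_mul trmxK.
have SbT : S *m b^T = a^T by rewrite -bS trmx_mul symS.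
have s1 : 1 + s != 0.
  apply: contraTneq (oner_neq0 F) => s1.
  have bG0 : b *m (S + a^T *m a) = 0.
    rewrite mulmxDr bS mulmxA baT mul_scalar_mx -{1}(scale1r a) -scalerDl.
    by rewrite s1 scale0r.
  have b0 : b = 0 by rewrite -(mulmxK unitG b) bG0 mul0mx.
  by rewrite -s1 /s b0 mul0mx mxE addr0 eqxx.
suff GK : (S + a^T *m a) *m (invmx S - (1 + s)^-1 *: (b^T *m b)) = 1%:M.
  by rewrite -[LHS]mulmx1 -GK mulKmx.
have aS : a *m invmx S = b by rewrite -bS mulmxK.
rewrite mulmxDl !mulmxBr mulmxV // -!scalemxAr mulmxA SbT.
rewrite -!mulmxA aS [a *m _]mulmxA abT mul_scalar_mx -scalemxAr scalerA.
rewrite -addrA [X in _ + X](_ : _ = 0) ?addr0 //.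
rewrite addrCA -opprD -scalerDl -{1}[(1 + s)^-1]mulr1 -mulrDr mulVf //.
by rewrite scale1r subrr.
Qed.

(** The Koszul trick.  Lowering the upper index of [L] turns compatibility into
    dg_k(a, b) = L_bak + L_abk, and the combination of the three cyclic
    permutations of this equation isolates 2 L_mjk because L is symmetric in
    its last two indices.  Here [dg k i j] plays the part of the derivative of
    g_ij in the k-th direction, for any family of directions. *)
Lemma metric_torsionfree_coefs (F : numFieldType) (n : nat) (g : 'M[F]_n)
    (dg L : 'I_n -> 'I_n -> 'I_n -> F) :
  g^T = g -> g \in unitmx ->
  (forall i j k, dg k i j - \sum_m g m j * L m i k
                 - \sum_m g i m * L m j k = 0) ->
  (forall i j k, L i j k = L i k j) ->
  forall i j k, L i j k =
    \sum_m 2^-1 * (dg k j m + dg j k m - dg m j k) * invmx g i m.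
Proof.
move=> symg unitg compat symL i j k.
pose low m j k := \sum_l g m l * L l j k.
have gC a b : g a b = g b a by rewrite -[in LHS]symg mxE.
have dgE a b c : dg c a b = low b a c + low a b c.
  move/eqP: (compat a b c); rewrite -addrA -opprD subr_eq0 => /eqP ->.
  by congr (_ + _); apply: eq_bigr => l _; rewrite gC.
have lowC m a b : low m a b = low m b a.
  by apply: eq_bigr => l _; rewrite symL.
have lowE m : 2^-1 * (dg k j m + dg j k m - dg m j k) = low m j k.
  rewrite !dgE (lowC m k j) (lowC j m k) (lowC k m j).
  have two0 : 2 != 0 :> F by rewrite pnatr_eq0.
  by field.
transitivity ((invmx g *m (g *m \col_l L l j k)) i 0).
  by rewrite mulKmx // mxE.
rewrite mxE; apply: eq_bigr => m _; rewrite lowE mulrC !mxE.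
by congr (_ * _); apply: eq_bigr => l _; rewrite mxE.
Qed.

(** * Derivatives on the jet bundle *)

(** Along a direction without x-component the base point in M does not move, so
    whatever depends on it alone may be treated as a constant. *)
Lemma derive_freeze (R : realType) (p n : nat)
    (F : 'rV[R]_n -> jets R p n -> R) (y v : jets R p n) :
  v.1.2 = 0 ->
  'D_v (fun z => F z.1.2 z) y = 'D_v (F y.1.2) y.
Proof.
move=> v0; rewrite /derive; congr (lim (_ @ 0^')).
by apply/funext => s /=; rewrite v0 scaler0 add0r.
Qed.

Lemma smooth_derivable_entry (R : realType) (V : normedModType R) (m n : nat)
    (U : set V) (f : V -> 'M[R]_(m, n)) (x v : V) i j :
  smooth_on U f -> U x -> derivable (fun z => f z i j) x v.
Proof.
move=> /(_ 1%N)[df _] /df/diff_derivable/derivable_mxP; exact.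
Qed.

(** * The metric g and its inverse *)

Lemma gmx_rank_one (R : realType) (p n : nat) (phi : 'rV[R]_n -> 'M[R]_n)
    (A : jets R p n -> 'rV[R]_n) (y : jets R p n) :
  gmx phi A y = phi y.1.2 + (A y)^T *m A y.
Proof. by apply/matrixP => i j; rewrite !mxE big_ord1 !mxE. Qed.

Lemma invmx_gmxE (R : realType) (p n : nat) (phi : 'rV[R]_n -> 'M[R]_n)
    (A : jets R p n -> 'rV[R]_n) (y : jets R p n) (i m : 'I_n) :
  (phi y.1.2)^T = phi y.1.2 -> phi y.1.2 \in unitmx ->
  gmx phi A y \in unitmx ->
  invmx (gmx phi A y) i m = invmx (phi y.1.2) i m
    - Aup phi A i y * Aup phi A m y / (1 + A0 phi A y).
Proof.
rewrite gmx_rank_one => symphi unitphi unitg.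
pose b := A y *m invmx (phi y.1.2).
have symV : (invmx (phi y.1.2))^T = invmx (phi y.1.2).
  by rewrite trmx_inv symphi.
have bE l : b 0 l = Aup phi A l y.
  by rewrite mxE; apply: eq_bigr => r _; rewrite mulrC -[in LHS]symV mxE.
have sE : (b *m (A y)^T) 0 0 = A0 phi A y.
  by rewrite mxE; apply: eq_bigr => l _; rewrite bE mxE.
have bbE : (b^T *m b) i m = Aup phi A i y * Aup phi A m y.
  by rewrite mxE big_ord1 [b^T _ _]mxE !bE.
rewrite (rank_one_update_inv symphi unitphi unitg (mulmxKV unitphi _)).
rewrite -/b sE; move: (b^T *m b) bbE => M ME.
by rewrite !mxE ME mulrC.
Qed.

(** The metric phi is differentiated through the projection to M, which replaces
    the direction [v] by its x-component. *)
Lemma derive_gmx (R : realType) (p n : nat) (phi : 'rV[R]_n -> 'M[R]_n)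
    (A : jets R p n -> 'rV[R]_n) (y v : jets R p n) (i j : 'I_n) :
  derivable (fun u => phi u i j) y.1.2 v.1.2 -> derivable A y v ->
  'D_v (fun z => gmx phi A z i j) y =
  'D_(v.1.2) (fun u => phi u i j) y.1.2 + 'D_v (fun z => A z 0 i * A z 0 j) y.
Proof.
move=> dphi /derivable_mxP dA.
have -> : (fun z => gmx phi A z i j) =
    (fun z => phi z.1.2 i j + A z 0 i * A z 0 j).
  by apply/funext => z; rewrite mxE.
(* The difference quotients of phi_ij along v and along its x-component are
   convertible, so both sides have the same first term. *)
exact: (deriveD (f := fun z : jets R p n => phi z.1.2 i j) dphi
  (derivableM (dA 0 i) (dA 0 j))).
Qed.

(** Since phi^im is constant along directions without x-component, it comes out
    of the derivative. *)
Lemma derive_raised_product (R : realType) (p n : nat)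
    (phi : 'rV[R]_n -> 'M[R]_n) (A : jets R p n -> 'rV[R]_n)
    (y v : jets R p n) (i j : 'I_n) :
  v.1.2 = 0 -> derivable A y v ->
  'D_v (fun z => Aup phi A i z * A z 0 j) y =
  \sum_m invmx (phi y.1.2) i m * 'D_v (fun z => A z 0 m * A z 0 j) y.
Proof.
move=> v0 /derivable_mxP dA.
rewrite (@derive_freeze R p n
  (fun u z => (\sum_m invmx (phi u) i m * A z 0 m) * A z 0 j)) //.
have dAA m : derivable (fun z => A z 0 m * A z 0 j) y v.
  exact: derivableM.
transitivity ('D_v (\sum_m (invmx (phi y.1.2) i m \*: (fun z => A z 0 m * A z 0 j))) y).
  congr ('D_v _ y); apply/funext => z; rewrite mulr_suml fct_sumE.
  by apply: eq_bigr => m _; rewrite -mulrA.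
rewrite derive_sum => [|m]; last exact: derivableZ.
by apply: eq_bigr => m _; rewrite deriveZ.
Qed.

(** * Adapted coefficients *)

Theorem theorem2p1 (R : realType) (p n : nat)
    (T : manifold R p) (M : manifold R n)
    (h : semi_riemannian T) (phi : semi_riemannian M) (A : dcovector T M)
    (hg : gmx_regular phi A)
    (D : linear_connection T M)
    (K : chart T -> chart M -> adapted_coefs R p n)
    (hC : is_cartan h phi A D K)
    (c : chart T) (d : chart M) (y : jets R p n) (hy : jdom c d y) :
  let H := met h c in
  let f := met phi d in
  let Ad := fun i z => dcomps A c d z 0 i in
  let Au := Aup f (dcomps A c d) in
  let a0 := A0 f (dcomps A c d) y in
  let B := berwald H f in
  [/\ forall g a b, cH (K c d) g a b y = christoffel H g a b y.1.1,
      forall i j g, cG (K c d) i j g y =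
        2^-1 * (tcov11 H B (fun k l z => Au k z * Ad l z) i j g y
                - \sum_m Au i y * Au m y / (1 + a0)
                    * tcov02 H B (fun k l z => Ad k z * Ad l z) m j g y),
      forall i j k, cL (K c d) i j k y =
        \sum_m (gamma_low f j k m y.1.2 + A_low f (dcomps A c d) j k m y)
               * (invmx (f y.1.2) i m - Au i y * Au m y / (1 + a0))
    & forall i j k g, cC (K c d) i j k g y =
        \sum_m C_low (dcomps A c d) j k m g y
               * (invmx (f y.1.2) i m - Au i y * Au m y / (1 + a0))].
Proof.
move=> H f Ad Au a0 B.
have [hK hKcartan] := hC.
have [compat_x compat_v cG_def symL symC] := hKcartan c d y hy.
have [_ hM] := hy.
have symf : (f y.1.2)^T = f y.1.2 by apply: met_sym.
have unitf : f y.1.2 \in unitmx.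
  by have [k sigf] := met_signature phi; exact: has_signature_unitmx (sigf d _ hM).
set g := gmx f (dcomps A c d) y.
have unitg : g \in unitmx by rewrite -row_full_unit /row_full hg.1.
have symg : g^T = g.
  by rewrite /g gmx_rank_one linearD /= trmx_mul trmxK symf.
have gVE i m := invmx_gmxE (A := dcomps A c d) i m symf unitf unitg.
have dA v : derivable (dcomps A c d) y v.
  by apply: diff_derivable; have [+ _] := dcomps_smooth A c d 1%N; apply.
have df v i j : derivable (fun u => f u i j) y.1.2 v.
  exact: smooth_derivable_entry (met_smooth phi d) hM.
have dg v i j := derive_gmx (df v.1.2 i j) (dA v).
split.
- by have [] := hK c d y hy.
- have sum0 (F : 'I_n -> R) : \sum_m F m * 0 = 0.
    by apply: big1 => m _; rewrite mulr0.
  move=> i j g0; rewrite cG_def /tcov11 /tcov02 /B /berwald /=.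
  rewrite /dt derive_raised_product // !sum0 addr0 subr0 -sumrB mulr_sumr.
  apply: eq_bigr => m _.
  rewrite dg derive0 add0r -/g gVE !sum0 !subr0 -mulrBl mulrA.
  by congr (_ * _); rewrite mulrC.
- move=> i j k.
  rewrite (metric_torsionfree_coefs symg unitg compat_x
    (fun i j k => symL j k i)).
  apply: eq_bigr => m _; rewrite gVE; congr (_ * _).
  rewrite /dx !dg /gamma_low /A_low /partial /dx /= -mulrDr; congr (_ * _).
  ring.
- move=> i j k c0.
  rewrite (@metric_torsionfree_coefs _ _ g
    (fun k i j => dv k c0 (fun z => gmx f (dcomps A c d) z i j) y)
    (fun i j k => cC (K c d) i j k c0 y) symg unitg (fun i j k => compat_v i j k c0)
    (fun i j k => symC i j k c0)).
  apply: eq_bigr => m _; rewrite gVE; congr (_ * _).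
  by rewrite /dv !dg /= !derive0 !add0r.
Qed.
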